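(* For each of the following pairs $(L,\ell)$ and every $\mathcal{L}(\Box,\mathbf{I})$-formula $A$, if $L\vdash A$ then $\ell\vdash A$: $(\mathbf{IL}^-(\mathbf{J4},\mathbf{J5}),\ \mathbf{il}^-(\mathbf{I4}))$; $(\mathbf{IL}^-(\mathbf{J2}),\ \mathbf{il}^-(\mathbf{I4}))$; $(\mathbf{IL}^-(\mathbf{J1},\mathbf{J4}),\ \mathbf{il}^-(\mathbf{J1}^u,\mathbf{I4}))$; $(\mathbf{IL}^-(\mathbf{J1},\mathbf{J4},\mathbf{J5}),\ \mathbf{il}^-(\mathbf{J15}^u,\mathbf{I4}))$.
   Context: The language $\mathcal{L}(\Box,\rhd)$ consists of propositional variables, $\bot$, $\to$, unary $\Box$ and binary $\rhd$; other connectives as usual, $\Diamond A:\equiv\neg\Box\neg A$, $\mathbf{I}A:\equiv\top\rhd A$; $\mathcal{L}(\Box,\mathbf{I})$-formulas are those built from variables and $\bot$ by $\to$, $\Box$, $\mathbf{I}$. The logic $\mathbf{IL}^-$ has as axioms all tautologies, $\Box(A\to B)\to(\Box A\to\Box B)$, $\Box(\Box A\to A)\to\Box A$, $\mathbf{J3}$: $(A\rhd C)\land(B\rhd C)\to(A\lor B)\rhd C$, $\mathbf{J6}$: $\Box A\leftrightarrow(\neg A\rhd\bot)$; rules: Modus Ponens, Necessitation, from $A\to B$ infer $(C\rhd A)\to(C\rhd B)$, and from $A\to B$ infer $(B\rhd C)\to(A\rhd C)$. Schemata: $\mathbf{J1}$: $\Box(A\to B)\to A\rhd B$; $\mathbf{J2}$: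 $(A\rhd B)\land(B\rhd C)\to A\rhd C$; $\mathbf{J4}$: $A\rhd B\to(\Diamond A\to\Diamond B)$; $\mathbf{J5}$: $\Diamond A\rhd A$. $L(\Sigma_1,\dots,\Sigma_k)$ is $L$ with schemata $\Sigma_i$ added as axioms. The logic $\mathbf{il}^-$ has as axioms all tautologies of $\mathcal{L}(\Box,\mathbf{I})$, $\Box(A\to B)\to(\Box A\to\Box B)$, $\Box(\Box A\to A)\to\Box A$, $\Box\bot\leftrightarrow\mathbf{I}\bot$; rules Modus Ponens, Necessitation, and from $A\to B$ infer $\mathbf{I}A\to\mathbf{I}B$. Schemata: $\mathbf{I4}$: $\mathbf{I}A\land\Diamond\top\to\Diamond A$; $\mathbf{J1}^u$: $\Box A\to\mathbf{I}A$; $\mathbf{J15}^u$: $\Box(A\lor\Diamond A)\to\mathbf{I}A$. *)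

(* Defs.v *)
From Stdlib Require Import List.
Import ListNotations.

Declare Scope rhd_scope.
Delimit Scope rhd_scope with rhd.
Declare Scope int_scope.
Delimit Scope int_scope with int.

Inductive form : Set :=
| Var (n : nat)
| Bot
| Imp (A B : form)
| Box (A : form)
| Rhd (A B : form).

Bind Scope rhd_scope with form.

Definition Neg (A : form) : form := Imp A Bot.
Definition Top : form := Neg Bot.
Definition Or (A B : form) : form := Imp (Neg A) B.
Definition And (A B : form) : form := Neg (Imp A (Neg B)).
Definition Iff (A B : form) : form := And (Imp A B) (Imp B A).
Definition Dia (A : form) : form := Neg (Box (Neg A)).
Definition Int (A : form) : form := Rhd Top A.

Notation "⊥" := Bot : rhd_scope.
Notation "⊤" := Top : rhd_scope.
Notation "~ A" := (Neg A) : rhd_scope.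
Notation "□ A" := (Box A) (at level 75, right associativity) : rhd_scope.
Notation "◇ A" := (Dia A) (at level 75, right associativity) : rhd_scope.
Notation "A ▷ B" := (Rhd A B) (at level 78, no associativity) : rhd_scope.
Notation "A /\ B" := (And A B) : rhd_scope.
Notation "A \/ B" := (Or A B) : rhd_scope.
Notation "A ⊃ B" := (Imp A B) (at level 90, right associativity) : rhd_scope.
Notation "A <-> B" := (Iff A B) : rhd_scope.

(* Modal formulas are evaluated as atoms, so the formulas true under every [v]
   are exactly the substitution instances of propositional tautologies. *)
Fixpoint eval (v : form -> bool) (A : form) : bool :=
  match A with
  | Bot => false
  | Imp B C => implb (eval v B) (eval v C)
  | _ => v A
  end.

Definition tautology (A : form) : Prop := forall v, eval v A = true.

Inductive J1 : form -> Prop :=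
| J1_intro A B : J1 (□ (A ⊃ B) ⊃ (A ▷ B)).
Inductive J2 : form -> Prop :=
| J2_intro A B C : J2 ((A ▷ B) /\ (B ▷ C) ⊃ (A ▷ C)).
Inductive J4 : form -> Prop :=
| J4_intro A B : J4 ((A ▷ B) ⊃ (◇ A ⊃ ◇ B)).
Inductive J5 : form -> Prop :=
| J5_intro A : J5 (◇ A ▷ A).

Inductive ILm (Sigmas : list (form -> Prop)) : form -> Prop :=
| ILm_schema S A : In S Sigmas -> S A -> ILm Sigmas A
| ILm_taut A : tautology A -> ILm Sigmas A
| ILm_K A B : ILm Sigmas (□ (A ⊃ B) ⊃ (□ A ⊃ □ B))
| ILm_L A : ILm Sigmas (□ (□ A ⊃ A) ⊃ □ A)
| ILm_J3 A B C : ILm Sigmas ((A ▷ C) /\ (B ▷ C) ⊃ ((A \/ B) ▷ C))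
| ILm_J6 A : ILm Sigmas (□ A <-> (~ A ▷ ⊥))
| ILm_mp A B : ILm Sigmas (A ⊃ B) -> ILm Sigmas A -> ILm Sigmas B
| ILm_nec A : ILm Sigmas A -> ILm Sigmas (□ A)
| ILm_R1 A B C : ILm Sigmas (A ⊃ B) -> ILm Sigmas ((C ▷ A) ⊃ (C ▷ B))
| ILm_R2 A B C : ILm Sigmas (A ⊃ B) -> ILm Sigmas ((B ▷ C) ⊃ (A ▷ C)).

Inductive iform : Set :=
| iVar (n : nat)
| iBot
| iImp (A B : iform)
| iBox (A : iform)
| iInt (A : iform).

Bind Scope int_scope with iform.

Definition iNeg (A : iform) : iform := iImp A iBot.
Definition iTop : iform := iNeg iBot.
Definition iOr (A B : iform) : iform := iImp (iNeg A) B.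
Definition iAnd (A B : iform) : iform := iNeg (iImp A (iNeg B)).
Definition iIff (A B : iform) : iform := iAnd (iImp A B) (iImp B A).
Definition iDia (A : iform) : iform := iNeg (iBox (iNeg A)).

Notation "⊥" := iBot : int_scope.
Notation "⊤" := iTop : int_scope.
Notation "~ A" := (iNeg A) : int_scope.
Notation "□ A" := (iBox A) : int_scope.
Notation "◇ A" := (iDia A) : int_scope.
Notation "'𝐈' A" := (iInt A) (at level 75, right associativity) : int_scope.
Notation "A /\ B" := (iAnd A B) : int_scope.
Notation "A \/ B" := (iOr A B) : int_scope.
Notation "A ⊃ B" := (iImp A B) : int_scope.
Notation "A <-> B" := (iIff A B) : int_scope.

(* L(Box, I) is a fragment of L(Box, Rhd), with I A read as Top Rhd A. *)
Fixpoint embed (A : iform) : form :=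
  match A with
  | iVar n => Var n
  | iBot => Bot
  | iImp B C => Imp (embed B) (embed C)
  | iBox B => Box (embed B)
  | iInt B => Int (embed B)
  end.

Fixpoint ieval (v : iform -> bool) (A : iform) : bool :=
  match A with
  | iBot => false
  | iImp B C => implb (ieval v B) (ieval v C)
  | _ => v A
  end.

Definition itautology (A : iform) : Prop := forall v, ieval v A = true.

Inductive I4 : iform -> Prop :=
| I4_intro A : I4 (𝐈 A /\ ◇ ⊤ ⊃ ◇ A).
Inductive J1u : iform -> Prop :=
| J1u_intro A : J1u (□ A ⊃ 𝐈 A).
Inductive J15u : iform -> Prop :=
| J15u_intro A : J15u (□ (A \/ ◇ A) ⊃ 𝐈 A).

Inductive ilm (Sigmas : list (iform -> Prop)) : iform -> Prop :=
| ilm_schema S A : In S Sigmas -> S A -> ilm Sigmas A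
| ilm_taut A : itautology A -> ilm Sigmas A
| ilm_K A B : ilm Sigmas (□ (A ⊃ B) ⊃ (□ A ⊃ □ B))
| ilm_L A : ilm Sigmas (□ (□ A ⊃ A) ⊃ □ A)
| ilm_I_bot : ilm Sigmas (□ ⊥ <-> 𝐈 ⊥)
| ilm_mp A B : ilm Sigmas (A ⊃ B) -> ilm Sigmas A -> ilm Sigmas B
| ilm_nec A : ilm Sigmas A -> ilm Sigmas (□ A)
| ilm_RI A B : ilm Sigmas (A ⊃ B) -> ilm Sigmas (𝐈 A ⊃ 𝐈 B).

(* Main.v *)
(* Read [A ▷ B] inside L(□, I) as [□ (A ⊃ X B) \/ 𝐈 B], where [X B] is [◇ B], [⊥], [B] and
   [B \/ ◇ B] for the four pairs respectively.  Under this reading every axiom and rule of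
   the ▷-logic becomes derivable in the I-logic, while [⊤ ▷ B] becomes [□ X B \/ 𝐈 B], which
   is equivalent to [𝐈 B]; so every L(□, I)-formula is equivalent to its own translation. *)
Require Import Defs.
From Stdlib Require Import List.
Import ListNotations.

Ltac itaut :=
  apply ilm_taut; let v := fresh "v" in intro v;
  unfold iIff, iAnd, iOr, iDia, iTop, iNeg; cbn;
  repeat match goal with
  | |- context [ieval v ?A] => destruct (ieval v A)
  | |- context [v ?A] => destruct (v A)
  end; reflexivity.

(** Moves a derivable fact into the antecedent of the goal. Derivations collect the modal facts they
    need in this way until what remains is a tautology for [itaut]. *)
Ltac use H := apply (fun h => ilm_mp _ _ _ h H).

Lemma ilm_box_mono S A B : ilm S (A ⊃ B)%int -> ilm S (□ A ⊃ □ B)%int.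
Proof. intros H. exact (ilm_mp _ _ _ (ilm_K _ _ _) (ilm_nec _ _ H)). Qed.

Lemma ilm_box_mono2 S A B C :
  ilm S (A ⊃ B ⊃ C)%int -> ilm S (□ A ⊃ □ B ⊃ □ C)%int.
Proof.
  intros H. use (ilm_K S B C). use (ilm_box_mono _ _ _ H). itaut.
Qed.

(** Transitivity from Löb's axiom, applied to [C = A /\ □ A]: since [□ C] yields [□ A], [A] alone
    implies [□ C ⊃ C]. *)
Lemma ilm_4 S A : ilm S (□ A ⊃ □ □ A)%int.
Proof.
  set (C := (A /\ □ A)%int).
  assert (HA : ilm S (□ C ⊃ □ A)%int) by (apply ilm_box_mono; itaut).
  assert (HB : ilm S (□ C ⊃ □ □ A)%int) by (apply ilm_box_mono; itaut).
  assert (HC : ilm S (□ A ⊃ □ (□ C ⊃ C))%int)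
    by (apply ilm_box_mono; use HA; itaut).
  use HB. use HC. use (ilm_L S C). itaut.
Qed.

Lemma ilm_box_bot_int S A : ilm S (□ ⊥ ⊃ 𝐈 A)%int.
Proof.
  assert (H : ilm S (𝐈 ⊥ ⊃ 𝐈 A)%int) by (apply ilm_RI; itaut).
  use H. use (ilm_I_bot S). itaut.
Qed.

(** [□ ⊥] implies [□ ~ A], so [◇ A] implies [□ ⊥ ⊃ ⊥]; Löb's axiom at [⊥] finishes. *)
Lemma ilm_box_dia_bot S A : ilm S (□ ◇ A ⊃ □ ⊥)%int.
Proof.
  assert (H : ilm S (□ ⊥ ⊃ □ ~ A)%int) by (apply ilm_box_mono; itaut).
  assert (HD : ilm S (□ ◇ A ⊃ □ (□ ⊥ ⊃ ⊥))%int)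
    by (apply ilm_box_mono; use H; itaut).
  use HD. use (ilm_L S iBot). itaut.
Qed.

(** What the translation demands of [X]: [adm_mono] serves the rule weakening the right side of [▷],
    [adm_dia] serves J4 and J6, and [adm_int] makes the reading of [⊤ ▷ A] collapse to [𝐈 A]. *)
Record admissible (S : list (iform -> Prop)) (X : iform -> iform) : Prop := {
  adm_mono A B : ilm S (A ⊃ B)%int -> ilm S (X A ⊃ X B)%int;
  adm_dia A : ilm S (□ ~ A ⊃ □ ~ X A)%int;
  adm_int A : ilm S (□ X A ⊃ 𝐈 A)%int }.

Definition rhd_tr (X : iform -> iform) (A B : iform) : iform :=
  (□ (A ⊃ X B) \/ 𝐈 B)%int.

Fixpoint tr (X : iform -> iform) (A : form) : iform :=
  match A with
  | Var n => iVar n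
  | Bot => iBot
  | Imp B C => iImp (tr X B) (tr X C)
  | Box B => iBox (tr X B)
  | Rhd B C => rhd_tr X (tr X B) (tr X C)
  end.

(** [tr] turns the atom [B ▷ C] into a compound formula, so the pulled-back valuation gives each
    modal formula the value of its whole translation. *)
Lemma ieval_tr X v A : ieval v (tr X A) = eval (fun B => ieval v (tr X B)) A.
Proof.
  induction A as [n| |A IHA B IHB|A IHA|A IHA B IHB]; cbn; try reflexivity.
  now rewrite IHA, IHB.
Qed.

Lemma tr_tautology X A : tautology A -> itautology (tr X A).
Proof. intros H v. rewrite ieval_tr. apply H. Qed.

Lemma tr_J1 S X A :
  (forall B, ilm S (B ⊃ X B)%int) -> J1 A -> ilm S (tr X A).
Proof.
  intros HX [B C]. cbn. unfold rhd_tr. set (b := tr X B). set (c := tr X C).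
  assert (H : ilm S (□ (b ⊃ c) ⊃ □ (b ⊃ X c))%int)
    by (apply ilm_box_mono; use (HX c); itaut).
  use H. itaut.
Qed.

(** Given [◇ b], the disjunct [□ (b ⊃ X c)] yields [◇ X c], hence [◇ c] by [adm_dia]; the disjunct
    [𝐈 c] yields [◇ c] by I4, as [◇ b] implies [◇ ⊤]. *)
Lemma tr_J4 S X A : admissible S X -> In I4 S -> J4 A -> ilm S (tr X A).
Proof.
  intros HX HI [B C]. cbn. unfold rhd_tr. set (b := tr X B). set (c := tr X C).
  assert (H1 : ilm S (□ (b ⊃ X c) ⊃ □ ~ X c ⊃ □ ~ b)%int)
    by (apply ilm_box_mono2; itaut).
  assert (H2 : ilm S (□ ~ ⊤ ⊃ □ ~ b)%int) by (apply ilm_box_mono; itaut).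
  assert (H3 : ilm S (𝐈 c /\ ◇ ⊤ ⊃ ◇ c)%int)
    by exact (ilm_schema _ _ _ HI (I4_intro c)).
  use H1. use H2. use H3. use (adm_dia _ _ HX c). itaut.
Qed.

Lemma tr_J5 S X A :
  (forall B, ilm S (◇ B ⊃ X B)%int) -> J5 A -> ilm S (tr X A).
Proof.
  intros HX [B]. cbn. unfold rhd_tr. use (ilm_nec _ _ (HX (tr X B))). itaut.
Qed.

(** The only case not immediate is [𝐈 c] with [□ ~ c]: I4 then refutes [◇ ⊤], so every boxed formula
    holds, in particular [□ ~ b]. *)
Lemma tr_J2 S A : In I4 S -> J2 A -> ilm S (tr (fun _ => iBot) A).
Proof.
  intros HI [B C D]. cbn. unfold rhd_tr.
  set (b := tr _ B). set (c := tr _ C). set (d := tr _ D).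
  assert (H1 : ilm S (□ ~ ⊤ ⊃ □ ~ b)%int) by (apply ilm_box_mono; itaut).
  assert (H2 : ilm S (𝐈 c /\ ◇ ⊤ ⊃ ◇ c)%int)
    by exact (ilm_schema _ _ _ HI (I4_intro c)).
  use H1. use H2. itaut.
Qed.

Lemma tr_sound Sigmas S X (HX : admissible S X)
    (HS : forall T A, In T Sigmas -> T A -> ilm S (tr X A)) A :
  ILm Sigmas A -> ilm S (tr X A).
Proof.
  induction 1 as [T A HT HA|A HA|A B|A|A B C|A|A B _ IH1 _ IH2|A _ IH
                 |A B C _ IH|A B C _ IH]; cbn in *; unfold rhd_tr.
  - exact (HS T A HT HA).
  - apply ilm_taut. now apply tr_tautology.
  - apply ilm_K.
  - apply ilm_L.
  - set (a := tr X A). set (b := tr X B). set (c := tr X C).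
    assert (H : ilm S (□ (a ⊃ X c) ⊃ □ (b ⊃ X c) ⊃ □ (a \/ b ⊃ X c))%int)
      by (apply ilm_box_mono2; itaut).
    use H. itaut.
  - set (a := tr X A).
    assert (Hbot : ilm S (□ ⊥ ⊃ □ a)%int) by (apply ilm_box_mono; itaut).
    (* [adm_dia] at [⊥]. Thus [X ⊥] is refuted under the box, which makes [□ (~ a ⊃ X ⊥)] equivalent
       to [□ a]; the other disjunct [𝐈 ⊥] is [□ ⊥], which implies [□ a]. *)
    assert (HXbot : ilm S (□ ~ X iBot)%int)
      by (use (ilm_nec S iTop ltac:(itaut)); apply adm_dia; exact HX).
    assert (Hto : ilm S (□ a ⊃ □ (~ a ⊃ X iBot))%int)
      by (apply ilm_box_mono; itaut).
    assert (Hof : ilm S (□ ~ X iBot ⊃ □ (~ a ⊃ X iBot) ⊃ □ a)%int)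
      by (apply ilm_box_mono2; itaut).
    use Hbot. use HXbot. use Hto. use Hof. use (ilm_I_bot S). itaut.
  - exact (ilm_mp _ _ _ IH1 IH2).
  - exact (ilm_nec _ _ IH).
  - set (a := tr X A) in *. set (b := tr X B) in *. set (c := tr X C).
    assert (H : ilm S (□ (c ⊃ X a) ⊃ □ (c ⊃ X b))%int)
      by (apply ilm_box_mono; use (adm_mono _ _ HX a b IH); itaut).
    use H. use (ilm_RI _ _ _ IH). itaut.
  - set (a := tr X A) in *. set (b := tr X B) in *. set (c := tr X C).
    assert (H : ilm S (□ (b ⊃ X c) ⊃ □ (a ⊃ X c))%int)
      by (apply ilm_box_mono; use IH; itaut).
    use H. itaut.
Qed.

Lemma tr_embed S X (HX : admissible S X) A : ilm S (tr X (embed A) <-> A)%int.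
Proof.
  induction A as [n| |A IHA B IHB|A IH|A IH]; cbn; unfold rhd_tr.
  - itaut.
  - itaut.
  - use IHA. use IHB. itaut.
  - set (a := tr X (embed A)) in *.
    assert (H1 : ilm S (□ a ⊃ □ A)%int) by (apply ilm_box_mono; use IH; itaut).
    assert (H2 : ilm S (□ A ⊃ □ a)%int) by (apply ilm_box_mono; use IH; itaut).
    use H1. use H2. itaut.
  - set (a := tr X (embed A)) in *.
    assert (H1 : ilm S (𝐈 a ⊃ 𝐈 A)%int) by (apply ilm_RI; use IH; itaut).
    assert (H2 : ilm S (𝐈 A ⊃ 𝐈 a)%int) by (apply ilm_RI; use IH; itaut).
    assert (H3 : ilm S (□ (⊤ ⊃ X a) ⊃ □ X a)%int)
      by (apply ilm_box_mono; itaut).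
    use H1. use H2. use H3. use (adm_int _ _ HX a). itaut.
Qed.

Lemma conservative Sigmas S X (HX : admissible S X)
    (HS : forall T A, In T Sigmas -> T A -> ilm S (tr X A)) A :
  ILm Sigmas (embed A) -> ilm S A.
Proof.
  intros H. use (tr_sound _ _ _ HX HS _ H). use (tr_embed _ _ HX A). itaut.
Qed.

Lemma admissible_dia S : admissible S iDia.
Proof.
  split; intros.
  - assert (H' : ilm S (□ ~ B ⊃ □ ~ A)%int) by (apply ilm_box_mono; use H; itaut).
    use H'. itaut.
  - assert (H : ilm S (□ □ ~ A ⊃ □ ~ ◇ A)%int) by (apply ilm_box_mono; itaut).
    use H. use (ilm_4 S (~ A)%int). itaut.
  (* [□ ◇ A] degenerates to [□ ⊥], hence to [𝐈 ⊥], which implies [𝐈 A]. *)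
  - use (ilm_box_dia_bot S A). use (ilm_box_bot_int S A). itaut.
Qed.

Lemma admissible_bot S : admissible S (fun _ => iBot).
Proof.
  split; intros.
  - itaut.
  - apply ilm_box_mono. itaut.
  - apply ilm_box_bot_int.
Qed.

Lemma admissible_id S : In J1u S -> admissible S (fun A => A).
Proof.
  intros HS. split; intros.
  - assumption.
  - itaut.
  - exact (ilm_schema _ _ _ HS (J1u_intro A)).
Qed.

Lemma admissible_or_dia S : In J15u S -> admissible S (fun A => (A \/ ◇ A)%int).
Proof.
  intros HS. split; intros.
  - use H. use (adm_mono _ _ (admissible_dia S) A B H). itaut.
  - assert (H : ilm S (□ ~ A ⊃ □ ~ ◇ A ⊃ □ ~ (A \/ ◇ A))%int)
      by (apply ilm_box_mono2; itaut).
    use H. use (adm_dia _ _ (admissible_dia S) A). itaut.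
  - exact (ilm_schema _ _ _ HS (J15u_intro A)).
Qed.

Theorem theorem4p13 :
  (forall A : iform, ILm [J4; J5] (embed A) -> ilm [I4] A) /\
  (forall A : iform, ILm [J2] (embed A) -> ilm [I4] A) /\
  (forall A : iform, ILm [J1; J4] (embed A) -> ilm [J1u; I4] A) /\
  (forall A : iform, ILm [J1; J4; J5] (embed A) -> ilm [J15u; I4] A).
Proof.
  (* [X] stays open here; the admissibility lemma chosen first in each case fixes it. *)
  repeat split; intros A; eapply conservative.
  - apply admissible_dia.
  - intros T B [<-|[<-|[]]] HB.
    + apply tr_J4; [apply admissible_dia | now left | assumption].
    + apply tr_J5; [intros; itaut | assumption].
  - apply admissible_bot.
  - intros T B [<-|[]] HB. apply tr_J2; [now left | assumption].
  - apply admissible_id. now left.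
  - intros T B [<-|[<-|[]]] HB.
    + apply tr_J1; [intros; itaut | assumption].
    + apply tr_J4; [apply admissible_id; now left | now right; left | assumption].
  - apply admissible_or_dia. now left.
  - intros T B [<-|[<-|[<-|[]]]] HB.
    + apply tr_J1; [intros; itaut | assumption].
    + apply tr_J4; [apply admissible_or_dia; now left | now right; left | assumption].
    + apply tr_J5; [intros; itaut | assumption].
Qed.
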